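(* Let $k$ be a field of characteristic zero, let $i\geq 2$ and $n>i$ be integers, and let $R_i=k[x_1,\ldots,x_i]\subset R_n=k[x_1,\ldots,x_n]$. Let $d_i$ be a $k$-derivation of $R_i$ with $d_i(x_j)\neq 0$ for all $1\leq j\leq i$, and let $d_n=d_i+g_i(x_i)\partial_{x_{i+1}}+\dots+g_{n-1}(x_{n-1})\partial_{x_n}$, where $g_j(x_j)\in k[x_j]\setminus k$ for all $i\leq j\leq n-1$. Let $l\in\mathbb{N}\cup\{\infty\}$ be such that $\deg_{x_i}g_i(x_i)\leq l$. Suppose that $d_i$ satisfies the following conditions: (i) if $d_i(r)=g(x_i)$ for some $r\in R_i$ and $g(x_i)\in k[x_i]$ with $\deg_{x_i}g(x_i)\leq l$, then $r\in k$ and $g=0$; (ii) there exists a matrix $A_{d_i}$ corresponding to $d_i$ which satisfies condition $(\ast)$; (iii) $\mathrm{Aut}(R_i)_{d_i}=\{\mathrm{Id}\}$. Then $\mathrm{Aut}(R_n)_{d_n}=\{(x_1,x_2,\dots,x_{n-1},x_n+c)\mid c\in k\}$.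
   Context: A $k$-derivation of a commutative $k$-algebra $R$ is a $k$-linear map $d:R\to R$ with $d(fg)=g\,d(f)+f\,d(g)$. The derivation $d_n$ is the $k$-derivation of $R_n$ determined by $d_n|_{R_i}=d_i$ and $d_n(x_{j+1})=g_j(x_j)$ for $i\leq j\leq n-1$. The isotropy group $\mathrm{Aut}(R)_d$ is the group of $k$-algebra automorphisms $\rho$ of $R$ with $\rho\circ d=d\circ\rho$. The tuple $(x_1,\dots,x_{n-1},x_n+c)$ denotes the $k$-automorphism with $x_j\mapsto x_j$ for $j<n$ and $x_n\mapsto x_n+c$. The zero polynomial counts as having degree $\leq l$; for $l=\infty$ the degree bound is vacuous. Matrix corresponding to $d_i$: write $h_j=d_i(x_j)\in R_i\setminus\{0\}$ for $1\leq j\leq i$. For each $j$ choose a monomial $x_1^{u_{j1}}\cdots x_i^{u_{ji}}$ occurring in $h_j$ with nonzero coefficient $\alpha_j\in k^*$ and such that $\sum_{q=1}^i u_{jq}$ equals the total degree of $h_j$. Then $A_{d_i}=[u_{jq}]_{1\leq j,q\leq i}$ is called a matrix corresponding to $d_i$ (it depends on the choices of monomials, hence is not unique). Condition $(\ast)$: an $i\times i$ integer matrix $M$ satisfies $(\ast)$ if the system of inequalities $(M-I)Y\leq 0$ (entrywise, $I$ the identity matrix) has no non-trivial (nonzero) solution $Y\in\mathbb{Z}_{\geq 0}^i$. *)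

(* Defs.v *)
(* Indices are 0-based: the variable x_j is 'X_(j-1), so the last variable x_n
   of k[x_1, ..., x_n] is 'X_j for the j : 'I_n with j.+1 = n. *)
From HB Require Import structures.
From mathcomp Require Import all_boot all_order all_algebra.
From mathcomp Require Export mpoly.

Set Implicit Arguments.
Unset Strict Implicit.
Unset Printing Implicit Defensive.

Import Order.TTheory GRing.Theory Num.Theory.

Local Open Scope ring_scope.

Definition is_derivation (k : fieldType) (R : comAlgType k) (d : R -> R) : Prop :=
  linear d /\ forall f g : R, d (f * g) = g * d f + f * d g.

Definition is_automorphism (k : fieldType) (R : comAlgType k) (rho : R -> R)
  : Prop :=
  [/\ linear rho, monoid_morphism rho & bijective rho].

Definition isotropy (k : fieldType) (R : comAlgType k) (d rho : R -> R) : Prop :=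
  is_automorphism rho /\ forall r : R, rho (d r) = d (rho r).

Definition last_ord (n : nat) (n_gt0 : (0 < n)%N) : 'I_n :=
  Ordinal (etrans (ltn_predL n) n_gt0).

Definition incl (k : fieldType) (m n : nat) (le_mn : (m <= n)%N)
    (p : {mpoly k[m]}) : {mpoly k[n]} :=
  p \mPo [tuple 'X_(widen_ord le_mn j) | j < m].

(* g(x_j) for a univariate polynomial g *)
Definition in_var (k : fieldType) (n : nat) (g : {poly k}) (j : 'I_n)
  : {mpoly k[n]} :=
  (map_poly (@mpolyC n k) g).['X_j].

(* None stands for l = oo. *)
Definition deg_le (k : fieldType) (l : option nat) (g : {poly k}) : Prop :=
  if l is Some m then (size g <= m.+1)%N else True.

Definition is_extension (k : fieldType) (i n : nat) (le_in : (i <= n)%N)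
    (di : {mpoly k[i]} -> {mpoly k[i]}) (g : nat -> {poly k})
    (dn : {mpoly k[n]} -> {mpoly k[n]}) : Prop :=
  [/\ is_derivation dn,
      forall p : {mpoly k[i]}, dn (incl le_in p) = incl le_in (di p)
    & (* g j is g_j: its argument x_j is 'X_a and x_(j+1) is 'X_b *)
      forall (j : nat) (a b : 'I_n),
        (i <= j)%N -> a.+1 = j -> b = j :> nat -> dn 'X_b = in_var (g j) a].

(* As msize is the total degree plus one, m is a monomial of di 'X_j of
   maximal total degree. *)
Definition corresponding_matrix (k : fieldType) (i : nat)
    (di : {mpoly k[i]} -> {mpoly k[i]}) (A : 'M[int]_i) : Prop :=
  forall j : 'I_i, exists m : 'X_{1..i},
    [/\ m \in msupp (di 'X_j),
        (mdeg m).+1 = msize (di 'X_j)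
      & forall q : 'I_i, A j q = (m q)%:Z].

Definition condition_star (i : nat) (M : 'M[int]_i) : Prop :=
  ~ exists Y : 'cV[int]_i,
      [/\ Y != 0,
          forall q : 'I_i, 0 <= Y q 0
        & forall j : 'I_i, ((M - 1%:M) *m Y) j 0 <= 0].

(* (x_1, ..., x_(n-1), x_n + c) *)
Definition shift_last (k : fieldType) (n : nat) (c : k) (p : {mpoly k[n]})
  : {mpoly k[n]} :=
  p \mPo [tuple if j.+1 == n then 'X_j + c%:MP else 'X_j | j < n].

(* Main.v *)
(* The partial derivative by x_n is a locally nilpotent derivation commuting
   with d_n, hence so is its conjugate by any rho in the isotropy group.  Every
   locally nilpotent derivation E of R_n commuting with d_n is a constant
   multiple of that partial derivative: otherwise the leading part of E in x_n
   is x_n^m times a locally nilpotent derivation of R_(n-1) commuting with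
   d_(n-1), which vanishes by exponentiation and (iii) when n - 1 = i, and is a
   multiple c of the derivative by x_(n-1), by induction, when n - 1 > i; in the
   latter case the next coefficient b of E(x_n) satisfies
   d_(n-1)(b) = c g_(n-1)'(x_(n-1)), and the analogue of (i) gives c = 0.
   Therefore rho preserves R_(n-1) and rho(x_n) = a x_n + b with a in k, and (i)
   forces b in k, a = 1, and rho = id on R_(n-1). *)
From HB Require Import structures.
Require Import Defs.
From mathcomp Require Import all_boot all_order all_algebra.
From mathcomp Require Import zify.
Import GRing.Theory.
Local Open Scope ring_scope.
Set Implicit Arguments.
Unset Strict Implicit.
Unset Printing Implicit Defensive.

(** * Derivations and rigidity over a ring with a structure map from k *)

(** The structure map [eta] stands in for an algebra structure, so that the same notions apply to
    [{poly S}] with [polyC \o eta]. For an additive [d], the two clauses together give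
    k-linearity. *)
Definition derivation_over (k : fieldType) (S : comNzRingType) (eta : k -> S)
    (d : S -> S) : Prop :=
  (forall f g, d (f * g) = g * d f + f * d g) /\ forall c, d (eta c) = 0.

Definition locally_nilpotent (S : nmodType) (d : S -> S) : Prop :=
  forall r, exists m, iter m d r = 0.

(** Encoded as an induction principle, the form in which a degree bound on generators spreads to the
    whole ring. *)
Definition finitely_generated (k : fieldType) (S : comNzRingType) (eta : k -> S) :
    Prop :=
  exists s : seq S, forall P : S -> Prop,
    (forall c, P (eta c)) ->
    (forall a b, P a -> P b -> P (a + b)) ->
    (forall a b, P a -> P b -> P (a * b)) ->
    (forall a, a \in s -> P a) -> forall r, P r.

(** Abstract form of condition (i); [N] bounds sizes, hence degrees strictly below [N]. *)
Definition no_primitive (k : fieldType) (S : comNzRingType) (eta : k -> S)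
    (d : S -> S) (x : S) (N : nat) : Prop :=
  forall (h : {poly k}) r, (size h <= N)%N -> d r = (map_poly eta h).[x] ->
    (exists c, r = eta c) /\ h = 0.

(* In [rigid_lnd] and [rigid_aut], x is the last variable: the constant c is 0
   over R_i, and arbitrary over R_n with n > i, where E = c d/dx_n and
   rho = (x_1, ..., x_n + c). *)
Definition rigid_lnd (k : fieldType) (S : comNzRingType) (eta : k -> S)
    (d : S -> S) (x : S) : Prop :=
  forall E : {additive S -> S}, derivation_over eta E -> locally_nilpotent E ->
    (forall r, E (d r) = d (E r)) ->
    exists2 c, E x = eta c & c = 0 -> forall r, E r = 0.

Definition rigid_aut (k : fieldType) (S : comNzRingType) (eta : k -> S)
    (d : S -> S) (x : S) : Prop :=
  forall rho : {rmorphism S -> S}, bijective rho ->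
    (forall c, rho (eta c) = eta c) -> (forall r, rho (d r) = d (rho r)) ->
    exists2 c, rho x = x + eta c & c = 0 -> forall r, rho r = r.

(** In characteristic zero the multiples of a nonzero [c] are pairwise distinct, and [g - g(0)]
    would vanish at too many of them. *)
Lemma periodic_poly (k : fieldType) (g : {poly k}) (c : k) :
  [pchar k] =i pred0 -> (1 < size g)%N -> g \Po ('X + c%:P) = g -> c = 0.
Proof.
move=> char0 g_nc gXc; apply/eqP/negP=> /negP c_neq0.
have per m : g.[c *+ m] = g.[0].
  elim: m => [|m <-]; first by rewrite mulr0n.
  by rewrite -[in RHS]gXc horner_comp !hornerE -mulrSr.
have : (size [seq c *+ m | m <- iota 0 (size g)] < size (g - g.[0]%:P)%R)%N.
  apply: max_poly_roots.
  - rewrite subr_eq0; apply/eqP=> g_c; have := g_nc.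
    by rewrite g_c ltnNge size_polyC_leq1.
  - by apply/allP=> _ /mapP[m _ ->]; rewrite rootE !hornerE per subrr.
  - rewrite map_inj_uniq ?iota_uniq // => m1 m2 /eqP.
    wlog le12 : m1 m2 / (m1 <= m2)%N.
      move=> W; case: (leqP m1 m2) => [/W//|/ltnW le21].
      by rewrite eq_sym => /(W _ _ le21).
    rewrite eq_sym -subr_eq0 -mulrnBr // -mulr_natr mulf_eq0 (negbTE c_neq0) /=.
    by rewrite ((pcharf0P k).1 char0) subn_eq0 => le21; apply/eqP; rewrite eqn_leq le12.
rewrite size_map size_iota ltnNge (leq_trans (size_polyD _ _)) //.
by rewrite size_polyN geq_max leqnn (leq_trans (size_polyC_leq1 _)) // ltnW.
Qed.

(** * One extension step: from [d] on S to [D] on S[X] with D X = g(x) *)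

Section PolynomialExtension.
Variables (k : fieldType) (char0 : [pchar k] =i pred0) (S : idomainType).
Variable eta : {rmorphism k -> S}.

Lemma natr_neq0 m : (m.+1%:R : S) != 0.
Proof.
by rewrite -(rmorph_nat eta) fmorph_eq0; rewrite ((pcharf0P k).1 char0).
Qed.

Lemma mulrSn_eq0 (a : S) m : (a *+ m.+1 == 0) = (a == 0).
Proof. by rewrite -mulr_natr mulf_eq0 (negbTE (natr_neq0 m)) orbF. Qed.

Lemma derivation_horner (d : {additive S -> S}) (x : S) (h : {poly k}) :
  derivation_over eta d ->
  d (map_poly eta h).[x] = (map_poly eta h^`()).[x] * d x.
Proof.
move=> [dM dk]; elim/poly_ind: h => [|h c IH].
  by rewrite deriv0 map_poly0 horner0 mul0r raddf0.
rewrite derivD derivC addr0 derivM derivX mulr1.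
rewrite !rmorphD !rmorphM /= map_polyX map_polyC !hornerE raddfD /= dk addr0.
by rewrite dM IH mulrDl -mulrA mulrCA.
Qed.

Variables (d : {additive S -> S}) (D : {additive {poly S} -> {poly S}}).
Variables (x : S) (g : {poly k}).
Let etaP : {rmorphism k -> {poly S}} := polyC \o eta.
Let a := (map_poly eta g).[x].
Hypothesis D_der : derivation_over etaP D.
Hypothesis D_C : forall s, D s%:P = (d s)%:P.
Hypothesis D_X : D 'X = a%:P.
Hypothesis g_nc : (1 < size g)%N.
Hypothesis prim : no_primitive eta d x (size g).

(** [D] acts as [d] on coefficients plus [a] times d/dX. *)
Lemma coef_D p j : (D p)`_j = d p`_j + (p`_j.+1 * a) *+ j.+1.
Proof.
elim/poly_ind: p j => [|p c IH] j.
  by rewrite raddf0 !coef0 raddf0 mul0r mul0rn addr0.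
rewrite raddfD D_der.1 D_C D_X !coefD coefXM coefMC !coefMX !coefC /= addr0.
case: j => [|j] /=; first by rewrite !add0r addrC mulr1n.
by rewrite IH !addr0 -addrA -mulrSr.
Qed.

(** The bound [N] is now arbitrary: a polynomial in X over k has constants of k as its coefficients,
    so comparing powers of X only ever involves constants and multiples of [g] as values of [d]. *)
Lemma no_primitive_poly N : no_primitive etaP D 'X N.
Proof.
move=> h r _ Dr.
have {}Dr j : d r`_j + (r`_j.+1 * a) *+ j.+1 = eta h`_j.
  by rewrite -coef_D Dr map_poly_comp -/(comp_poly 'X _) comp_polyXr coef_map.
(* When the next coefficient vanishes, so does the term in [a], and [prim] applies to the constant
   polynomial h_j. *)
have r_const j : r`_j.+1 = 0 -> (exists c, r`_j = eta c) /\ h`_j = 0.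
  move=> rj; have := Dr j; rewrite rj mul0r mul0rn addr0 => dr.
  have [||c hj0] := @prim (h`_j)%:P r`_j.
  - by rewrite (leq_trans (size_polyC_leq1 _)) // ltnW.
  - by rewrite map_polyC hornerC.
  - by split=> //; move: hj0 => /(congr1 (coefp 0)); rewrite /= coefC coef0.
have size_r : (size r <= 1)%N.
  rewrite leqNgt; apply/negP=> r_gt1.
  have [s size_rE] : exists s, size r = s.+2.
    by case: (size r) r_gt1 => [|[|s]] // _; exists s.
  have [|[c rc] _] := r_const s.+1; first by rewrite nth_default ?size_rE.
  (* If r had positive degree s+1 with top coefficient c, then d r_s would be (h_s - (s+1) c g)(x).
     By [prim] this polynomial is zero; as [g] is nonconstant, its coefficient at the degree of [g]
     gives c = 0. *)
  have := Dr s; rewrite rc => drs.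
  have [||_ hg] := @prim ((h`_s)%:P - (c *+ s.+1) *: g) r`_s.
  - rewrite (leq_trans (size_polyD _ _)) // size_polyN geq_max.
    by rewrite (leq_trans (size_polyC_leq1 _)) ?(ltnW g_nc) //= size_scale_leq.
  - rewrite rmorphB /= map_polyC /= map_polyZ /= !hornerE -/a -drs rmorphMn /=.
    by rewrite mulrnAl addrK.
  move: hg => /(congr1 (coefp (size g).-1)); rewrite /= coefB coefC coefZ coef0.
  have -> : (size g).-1 == 0%N = false by case: (size g) g_nc => [|[]].
  rewrite sub0r => /eqP; rewrite oppr_eq0 mulf_eq0 -/(lead_coef g).
  rewrite lead_coef_eq0 -size_poly_eq0 -mulr_natr mulf_eq0.
  rewrite (negbTE (_ : s.+1%:R != 0)) ?((pcharf0P k).1 char0) //.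
  case/orP=> [|/eqP gs]; last by have := g_nc; rewrite gs.
  rewrite orbF => /eqP c0; move: rc; rewrite c0 rmorph0.
  have -> : r`_s.+1 = lead_coef r by rewrite /lead_coef size_rE.
  by move/eqP; rewrite lead_coef_eq0 -size_poly_eq0 size_rE.
have r0 j : r`_j.+1 = 0 by rewrite nth_default // (leq_trans size_r).
split; last first.
  by apply/polyP=> j; rewrite coef0; case: (r_const j (r0 j)).
have [[c rc] _] := r_const 0%N (r0 0%N).
by exists c; rewrite (size1_polyC size_r) rc.
Qed.


(** * Locally nilpotent derivations of S[X] commuting with [D] *)

Section LND.
Variable E : {additive {poly S} -> {poly S}}.
Hypothesis E_der : derivation_over etaP E.

(* The part of degree m of E in X is E_m X^m + b X^(m+1) d/dX, with E_m s the
   coefficient of X^m in E s, and b that of X^(m+1) in E X. *)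
Lemma lead_coef_der (m : nat) :
    (forall s : S, (size (E s%:P) <= m.+1)%N) -> (size (E 'X) <= m.+2)%N ->
  forall q (p : {poly S}), (size p <= q.+1)%N ->
    (size (E p) <= (q + m).+1)%N /\
    (E p)`_(q + m) = (E (p`_q)%:P)`_m + (p`_q * (E 'X)`_m.+1) *+ q.
Proof.
move=> EC EX; elim=> [|q IH] p.
  by move=> /size1_polyC->; rewrite coefC /= mulr0n addr0; split=> //; exact: EC.
elim/poly_ind: p => [|p c _] size_p.
  by rewrite raddf0 !coef0 polyC0 raddf0 coef0 size_poly0 mul0r mul0rn addr0.
have {}size_p : (size p <= q.+1)%N.
  have [->|p_neq0] := eqVneq p 0; first by rewrite size_poly0.
  by move: size_p; rewrite size_MXaddC (negbTE p_neq0).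
have [size_E E_q] := IH _ size_p.
have -> : E (p * 'X + c%:P) = E p * 'X + p * E 'X + E c%:P.
  by rewrite raddfD E_der.1 (mulrC 'X).
have size1 : (size (E p * 'X)%R <= (q.+1 + m).+1)%N.
  have := size_polyMleq (E p) 'X; rewrite size_polyX; lia.
have size2 : (size (p * E 'X)%R <= (q.+1 + m).+1)%N.
  have := size_polyMleq p (E 'X); lia.
have size3 : (size (E c%:P) <= (q + m).+1)%N by have := EC c; lia.
split.
  rewrite (leq_trans (size_polyD _ _)) // geq_max (leq_trans size3) ?andbT; last lia.
  by rewrite (leq_trans (size_polyD _ _)) // geq_max size1 size2.
rewrite addSn !coefD !coefMX !coefC /= E_q addr0 [(E c%:P)`__]nth_default // addr0.
suff -> : (p * E 'X)`_(q + m).+1 = p`_q * (E 'X)`_m.+1.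
  by rewrite mulrSr addrA.
rewrite -addnS.
have qlt : (q < (q + m.+1).+1)%N by rewrite ltnS leq_addr.
rewrite coefM (bigD1 (Ordinal qlt)) //= addKn big1 ?addr0 // => j.
rewrite -val_eqE /= neq_ltn => /orP[j_lt|j_gt].
  rewrite [(E 'X)`__]nth_default ?mulr0 // (leq_trans EX) //.
  lia.
by rewrite nth_default ?mul0r // (leq_trans size_p).
Qed.


Definition coef_der m (s : S) : S := (E s%:P)`_m.

Lemma coef_der_additive m : nmod_morphism (coef_der m).
Proof.
by split=> [|u v]; rewrite /coef_der ?polyC0 ?raddf0 ?coef0 // polyCD raddfD coefD.
Qed.

HB.instance Definition _ m :=
  GRing.isNmodMorphism.Build S S (coef_der m) (coef_der_additive m).

Lemma coef_der_derivation m : derivation_over eta (coef_der m).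
Proof.
split=> [u v|c]; rewrite /coef_der; last by rewrite [E _]E_der.2 coef0.
by rewrite polyCM E_der.1 coefD !coefCM.
Qed.

Hypothesis E_lnd : locally_nilpotent E.
Hypothesis E_D : forall p, E (D p) = D (E p).
Hypothesis lnd : rigid_lnd eta d x.

Lemma deriv_neq0 : g^`() != 0.
Proof.
apply/eqP=> /(congr1 (coefp (size g).-2)) /eqP; rewrite /= coef_deriv coef0.
case size_g: (size g) g_nc => [|[|s]] //= _.
rewrite -mulr_natr mulf_eq0 ((pcharf0P k).1 char0) orbF.
have -> : g`_s.+1 = lead_coef g by rewrite /lead_coef size_g.
by rewrite lead_coef_eq0 -size_poly_eq0 size_g.
Qed.

(** The part of degree [m] of [E] vanishes: first b, which is a constant by [prim] and zero by local
    nilpotency on X; then E_m, by rigidity of S once its value on [x] is shown to be zero. *)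
Lemma der_descent m :
    (forall s : S, (size (E s%:P) <= m.+1)%N) -> (size (E 'X) <= m.+2)%N ->
  (forall s : S, (size (E s%:P) <= m)%N) /\ (size (E 'X) <= m.+1)%N.
Proof.
move=> EC EX.
have lead := lead_coef_der EC EX.
have Em_d s : coef_der m (d s) = d (coef_der m s).
  rewrite /coef_der -D_C E_D coef_D [(E s%:P)`_m.+1]nth_default //.
  by rewrite mul0r mul0rn addr0.
have d_EX j : d (E 'X)`_j + ((E 'X)`_j.+1 * a) *+ j.+1 = coef_der j a.
  by rewrite -coef_D -E_D D_X.
have db : d (E 'X)`_m.+1 = 0.
  have := d_EX m.+1; rewrite [(E 'X)`_m.+2]nth_default // mul0r mul0rn addr0.
  by move->; rewrite /coef_der nth_default.
have [||[c b_c] _] := @prim 0 (E 'X)`_m.+1; rewrite ?size_poly0 //.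
  by rewrite map_poly0 horner0.
have c0 : c = 0.
  have [t Et] := E_lnd 'X.
  (* The leading part sends u X^(1+jm), with u in k, to (1+jm) c u X^(1+(j+1)m). The product is
     nonzero in characteristic zero, so E^t X = 0 forces c = 0. *)
  have [_] : (size (iter t E 'X) <= (1 + t * m).+1)%N /\
     (iter t E 'X)`_(1 + t * m) = eta (c ^+ t * \prod_(j < t) (1 + j * m)%:R).
    elim: t {Et} => [|t [size_t coef_t]].
      by rewrite mul0n addn0 /= size_polyX coefX big_ord0 mulr1 expr0 rmorph1.
    have [size_E coef_E] := lead _ _ size_t.
    have -> : (1 + t.+1 * m = 1 + t * m + m)%N by rewrite mulSn; lia.
    rewrite iterS; split=> //.
    rewrite coef_E coef_t [(E _)`_m](congr1 (coefp m) (E_der.2 _)) /= coef0 add0r b_c.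
    rewrite -rmorphM -rmorphMn /= big_ord_recr exprSr -mulr_natr /=.
    by congr (eta _); rewrite -!mulrA; congr (_ * _); rewrite mulrCA mulrA mulrC.
  rewrite Et coef0 => /esym/eqP; rewrite fmorph_eq0 mulf_eq0 expf_eq0.
  rewrite (negbTE (_ : \prod_j _ != 0)) ?orbF; first by case/andP=> _ /eqP.
  by apply/prodf_neq0=> j _; rewrite ((pcharf0P k).1 char0).
have b0 : (E 'X)`_m.+1 = 0 by rewrite b_c c0 rmorph0.
have EX' : (size (E 'X) <= m.+1)%N.
  apply/leq_sizeP=> j; rewrite leq_eqVlt => /predU1P[<-//|m_j].
  exact: (leq_sizeP _ _ EX).
split=> // s.
(* With b = 0, the coefficient of E^t r in degree tm is E_m^t r, so E_m inherits local
   nilpotency. *)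
have Em_lnd : locally_nilpotent (coef_der m).
  move=> r; have [t Et] := E_lnd r%:P; exists t.
  have [_ <-] : (size (iter t E r%:P) <= (t * m).+1)%N /\
     (iter t E r%:P)`_(t * m) = iter t (coef_der m) r; last by rewrite Et coef0.
  elim: t {Et} => [|t [size_t coef_t]].
    by rewrite mul0n coefC size_polyC_leq1.
  have [size_E coef_E] := lead _ _ size_t.
  rewrite !iterS mulSn addnC; split=> //.
  by rewrite coef_E coef_t b0 mulr0 mul0rn addr0.
have [e Em_x Em0] := lnd (coef_der_derivation m) Em_lnd Em_d.
have {}Em0 : coef_der m s = 0.
  (* The coefficient of X^m in D(E X) = E(a) now reads d((E X)_m) = E_m(g(x)) = e g'(x). The size of
     e g' is within the bound of [prim], so e g' = 0 and e = 0. *)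
  apply: Em0; have := d_EX m; rewrite b0 mul0r mul0rn addr0 => db'.
  have [||_ /eqP] := @prim (e *: g^`()) (E 'X)`_m.
  - rewrite (leq_trans (size_scale_leq _ _)) //.
    by rewrite (leq_trans (size_poly _ _)) ?leq_pred.
  - rewrite db' derivation_horner; last exact: coef_der_derivation.
    by rewrite Em_x map_polyZ /= hornerZ mulrC.
  - by rewrite scaler_eq0 (negbTE deriv_neq0) orbF => /eqP.
apply/leq_sizeP=> j; rewrite leq_eqVlt => /predU1P[<-//|m_j].
exact: (leq_sizeP _ _ (EC s)).
Qed.

(** Finite generation bounds the X-degree of [E] uniformly on S, and [der_descent] lowers the bound
    until [E] kills S and E X lies in S. Then d(E X) = 0, so [prim] puts E X in k. *)
Lemma lnd_poly : finitely_generated eta ->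
  exists c, forall p, E p = (eta c)%:P * p^`().
Proof.
case=> gens gensP.
have [m [EC EX]] : exists m, (forall s, (size (E s%:P) <= m)%N) /\
    (size (E 'X) <= m.+1)%N.
  exists (maxn (\max_(s <- gens) size (E s%:P)) (size (E 'X))).
  split=> [s|]; last by rewrite leqW // leq_maxr.
  rewrite leq_max; apply/orP; left; move: s; apply: gensP.
  - by move=> c; rewrite [E _]E_der.2 size_poly0.
  - move=> u v Eu Ev; rewrite polyCD raddfD (leq_trans (size_polyD _ _)) //.
    by rewrite geq_max Eu.
  - move=> u v Eu Ev; rewrite polyCM E_der.1 (leq_trans (size_polyD _ _)) //.
    by rewrite geq_max !mul_polyC !(leq_trans (size_scale_leq _ _)).
  - by move=> u gens_u; apply: leq_bigmax_seq.
elim: m EC EX => [|m IH] EC EX; last by case: (der_descent EC EX).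
have {}EC s : E s%:P = 0 by apply/eqP; rewrite -size_poly_leq0.
have {EX} [b EX] : exists b, E 'X = b%:P by exists (E 'X)`_0; apply: size1_polyC.
have [||[c b_c] _] := @prim 0 b; rewrite ?size_poly0 //.
  by rewrite map_poly0 horner0; apply: polyC_inj; rewrite -D_C -EX -E_D D_X EC.
exists c; elim/poly_ind=> [|p s IH]; first by rewrite deriv0 mulr0 raddf0.
rewrite raddfD E_der.1 EC addr0 IH EX b_c derivD derivC addr0 derivM derivX mulr1.
by rewrite mulrDr mulrCA ['X * _]mulrC [p * _]mulrC.
Qed.


End LND.

(** * Automorphisms of S[X] commuting with [D] *)

Hypothesis fg : finitely_generated eta.
Hypothesis lnd : rigid_lnd eta d x.
Hypothesis aut : rigid_aut eta d x.

(** As [a] does not involve X, d/dX commutes with [D]; this makes its conjugates eligible for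
    [lnd_poly]. *)
Lemma deriv_D p : (D p)^`() = D p^`().
Proof.
apply/polyP=> j; rewrite coef_deriv !coef_D !coef_deriv mulrnDl raddfMn /=.
by rewrite mulrnAl -!mulrnA mulnC.
Qed.

Lemma deriv_eq0 (p : {poly S}) : p^`() = 0 -> p = (p`_0)%:P.
Proof.
move=> p'0; apply: size1_polyC; apply/leq_sizeP=> -[|j] // _.
by apply/eqP; rewrite -(mulrSn_eq0 _ j) -coef_deriv p'0 coef0.
Qed.

(** The conjugate of d/dX by [rho] is a constant multiple of d/dX by [lnd_poly]. The constant is
    nonzero because [rho] fixes 1, the derivative of X. *)
Lemma conj_deriv (rho sigma : {rmorphism {poly S} -> {poly S}}) :
    cancel rho sigma -> cancel sigma rho ->
    (forall c, rho (etaP c) = etaP c) -> (forall p, rho (D p) = D (rho p)) ->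
  exists2 c, c != 0 & forall p, rho p^`() = (eta c)%:P * (rho p)^`().
Proof.
move=> rhoK sigmaK rho_k rho_D.
have sigma_k c : sigma (etaP c) = etaP c by rewrite -{1}rho_k rhoK.
have sigma_D p : sigma (D p) = D (sigma p) by rewrite -{1}[p]sigmaK -rho_D rhoK.
pose E : {additive {poly S} -> {poly S}} := rho \o (@deriv S) \o sigma.
have E_der : derivation_over etaP E.
  split=> [p q|c]; rewrite /E /=; last first.
    by rewrite sigma_k /= derivC rmorph0.
  rewrite rmorphM derivM rmorphD !rmorphM !sigmaK addrC [_ * q]mulrC.
  by rewrite addrC.
have E_lnd : locally_nilpotent E.
  move=> p; exists (size (sigma p)).
  suff -> t : iter t E p = rho (sigma p)^`(t) by rewrite derivn_poly0 ?rmorph0.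
  by elim: t => [|t IH]; rewrite ?derivn0 ?sigmaK //= IH /E /= rhoK.
have [p|c Ec] := lnd_poly E_der E_lnd _ lnd fg.
  by rewrite /E /= sigma_D deriv_D rho_D.
have {}Ec p : rho p^`() = (eta c)%:P * (rho p)^`() by rewrite -Ec /E /= rhoK.
exists c => //; apply/eqP=> c0.
have := Ec 'X; rewrite derivX rmorph1 c0 rmorph0 mul0r => /eqP.
by rewrite oner_eq0.
Qed.

Lemma aut_poly (rho : {rmorphism {poly S} -> {poly S}}) : bijective rho ->
    (forall c, rho (etaP c) = etaP c) -> (forall p, rho (D p) = D (rho p)) ->
  (forall s, rho s%:P = s%:P) /\ exists c, rho 'X = 'X + (eta c)%:P.
Proof.
move=> [sigma0 rhoK sigmaK] rho_k rho_D.
pose sigma : {rmorphism {poly S} -> {poly S}} := HB.pack sigma0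
  (GRing.isZmodMorphism.Build _ _ sigma0 (can2_zmod_morphism rhoK sigmaK))
  (GRing.isMonoidMorphism.Build _ _ sigma0 (can2_monoid_morphism rhoK sigmaK)).
have rhoK1 : cancel rho sigma by [].
have sigmaK1 : cancel sigma rho by [].
have sigma_k c : sigma (etaP c) = etaP c by rewrite -{1}rho_k rhoK1.
have sigma_D p : sigma (D p) = D (sigma p) by rewrite -{1}[p]sigmaK1 -rho_D rhoK1.
have [c c_neq0 rho'] := conj_deriv rhoK1 sigmaK1 rho_k rho_D.
(* S is the kernel of d/dX, so it is stable under [rho] and under its inverse; hence [rho] restricts
   to an automorphism [rho0] of S, to which [aut] applies. *)
have preserves (f : {rmorphism {poly S} -> {poly S}}) e : e != 0 ->
    (forall p, f p^`() = (eta e)%:P * (f p)^`()) ->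
    forall s, f s%:P = ((f s%:P)`_0)%:P.
  move=> e_neq0 f' s; apply: deriv_eq0; apply/eqP.
  have /eqP := f' s%:P; rewrite derivC rmorph0 eq_sym mulf_eq0.
  by rewrite polyC_eq0 fmorph_eq0 (negbTE e_neq0).
have [e e_neq0 sigma'] := conj_deriv sigmaK1 rhoK1 sigma_k sigma_D.
have rhoC := preserves _ _ c_neq0 rho'.
have sigmaC := preserves _ _ e_neq0 sigma'.
pose rho0 : {rmorphism S -> S} := coefp 0 \o rho \o polyC.
pose sig0 : {rmorphism S -> S} := coefp 0 \o sigma \o polyC.
have rho0E s : rho s%:P = (rho0 s)%:P by exact: rhoC.
have sig0E s : sigma s%:P = (sig0 s)%:P by exact: sigmaC.
have rho0_k z : rho0 (eta z) = eta z.
  by apply: polyC_inj; rewrite -rho0E; exact: rho_k.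
have [|//|s|c1 rho0_x rho0_id] := aut (rho := rho0).
- by exists sig0 => s; apply: polyC_inj; rewrite -?sig0E -?rho0E -?sig0E ?rhoK1 ?sigmaK1.
- by apply: polyC_inj; rewrite -rho0E -!D_C rho_D rho0E.
have [b rhoX] : exists b, rho 'X = (eta c^-1)%:P * 'X + b%:P.
  exists (rho 'X - (eta c^-1)%:P * 'X)`_0.
  rewrite -deriv_eq0 ?subrKC //.
  rewrite derivB derivM derivC mul0r add0r derivX mulr1.
  have := rho' 'X; rewrite derivX rmorph1 => /(congr1 (fun p => (eta c^-1)%:P * p)).
  by rewrite mulrA -polyCM -(rmorphM eta) mulVf // rmorph1 mul1r mulr1 => ->; rewrite subrr.
have rho0_a : rho0 a = (map_poly eta g).[rho0 x].
  rewrite /a -(horner_map rho0) -map_poly_comp; congr (_.[_]).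
  exact: eq_map_poly.
(* Comparing rho(D X) with D(rho X) gives g(x + c1) = c^-1 g(x) + d b. *)
have db : d b = (map_poly eta (g \Po ('X + c1%:P) - c^-1 *: g)).[x].
  have : (map_poly eta g).[x + eta c1] = eta c^-1 * a + d b.
    rewrite -rho0_x -rho0_a; apply: polyC_inj; rewrite -rho0E -D_X rho_D rhoX raddfD D_der.1.
    by rewrite [D (eta _)%:P](D_der.2 _) D_C D_X mulr0 add0r polyCD polyCM.
  rewrite rmorphB /= map_polyZ map_comp_poly rmorphD /= map_polyX map_polyC /=.
  rewrite hornerD hornerN hornerZ horner_comp !hornerE -/a.
  by move->; rewrite addrC addKr.
have size_Xc : size ('X + c1%:P) = 2 by rewrite size_XaddC.
have [||[e1 b_e1] /eqP] := @prim (g \Po ('X + c1%:P) - c^-1 *: g) b => //.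
  rewrite (leq_trans (size_polyD _ _)) // size_polyN geq_max size_comp_poly2 //.
  by rewrite leqnn size_scale_leq.
rewrite subr_eq0 => /eqP gXc.
have g_neq0 : g != 0 by rewrite -size_poly_eq0 -lt0n ltnW.
(* A translation keeps the leading coefficient of [g], so c = 1; then [g] is invariant under
   translation by [c1], which must be 0. *)
have cV1 : c^-1 = 1.
  have := congr1 lead_coef gXc; rewrite lead_coef_comp ?size_Xc // lead_coefXaddC.
  rewrite expr1n mulr1 lead_coefZ -{1}[lead_coef g]mul1r => /mulIf -> //.
  by rewrite lead_coef_eq0.
have c10 : c1 = 0 by apply: (periodic_poly char0 g_nc); rewrite gXc cV1 scale1r.
split; first by move=> s; rewrite rho0E rho0_id.
by exists e1; rewrite rhoX cV1 rmorph1 mul1r b_e1.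
Qed.

End PolynomialExtension.

(** * Exponentials of locally nilpotent derivations *)

Section Exponential.
Variables (k : fieldType) (char0 : [pchar k] =i pred0) (A : comAlgType k).
Variable E : {linear A -> A}.
Hypothesis E_der : is_derivation E.
Hypothesis E_lnd : locally_nilpotent E.

Lemma der_scalar c : E c%:A = 0.
Proof.
have E1 : E 1 = 0.
  by apply: (addIr (E 1)); rewrite add0r -{3}[1]mulr1 E_der.2 !mul1r.
by rewrite linearZ /= E1 scaler0.
Qed.

Lemma map_derM (P Q : {poly A}) :
  map_poly E (P * Q) = Q * map_poly E P + P * map_poly E Q.
Proof.
apply/polyP=> m; rewrite coef_map /= coefD [Q * _]mulrC !coefM linear_sum -big_split /=.
by apply: eq_bigr=> j _; rewrite E_der.2 !coef_map /= [Q`__ * _]mulrC.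
Qed.

Lemma map_derX : map_poly E 'X = 0.
Proof.
apply/polyP=> m; rewrite coef_map coef0 coefX /=.
by case: eqP => _; rewrite ?raddf0 // -[1%:R]scale1r der_scalar.
Qed.

Lemma map_der_translate c : map_poly E ('X + c%:A%:P) = 0.
Proof. by rewrite raddfD /= map_derX map_polyC /= der_scalar addr0. Qed.

(* P = sum_m (E^m r / m!) X^m = exp(X E) r is the only solution of
   P' = E P with P(0) = r, so identities between exponentials reduce to this
   differential equation. *)
Definition flow (P : {poly A}) := P^`() = map_poly E P.

Lemma flow_coef P m : flow P -> P`_m = (m`!%:R^-1 : k) *: iter m E P`_0.
Proof.
move=> flP; elim: m => [|m IH]; first by rewrite fact0 invr1 scale1r.
have m1 : m.+1%:R != 0 :> k by rewrite ((pcharf0P k).1 char0).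
have := congr1 (coefp m) flP; rewrite /= coef_deriv coef_map /= IH linearZ /=.
rewrite -scaler_nat => /(congr1 (fun y => (m.+1%:R^-1 : k) *: y)).
by rewrite !scalerA mulVf // scale1r => ->; rewrite factS natrM invfM.
Qed.

Lemma flow_eq P Q : flow P -> flow Q -> P`_0 = Q`_0 -> P = Q.
Proof.
by move=> flP flQ PQ; apply/polyP=> m; rewrite (flow_coef m flP) PQ -flow_coef.
Qed.

Fact orderP r : exists m, iter m E r == 0.
Proof. by have [m /eqP] := E_lnd r; exists m. Qed.

(** Truncation at the least order killing [r] makes exp(X E) r a polynomial without losing any
    nonzero term. *)
Definition flow_poly (r : A) : {poly A} :=
  \poly_(m < ex_minn (orderP r)) ((m`!%:R^-1 : k) *: iter m E r).

Lemma coef_flow_poly r m : (flow_poly r)`_m = (m`!%:R^-1 : k) *: iter m E r.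
Proof.
rewrite coef_poly; case: ex_minnP => N /eqP EN _; case: ltnP => // N_m.
suff -> : iter m E r = 0 by rewrite scaler0.
rewrite -(subnK N_m) iterD EN.
by elim: (m - N)%N => //= t ->; rewrite raddf0.
Qed.

Lemma flow_poly0 r : (flow_poly r)`_0 = r.
Proof. by rewrite coef_flow_poly fact0 invr1 scale1r. Qed.

Lemma flow_polyP r : flow (flow_poly r).
Proof.
apply/polyP=> m; rewrite coef_deriv coef_map !coef_flow_poly /= linearZ /=.
rewrite -scaler_nat scalerA factS natrM invfM mulrA mulfV ?mul1r //.
by rewrite ((pcharf0P k).1 char0).
Qed.

Lemma flow_polyE P : flow P -> flow_poly P`_0 = P.
Proof. by move=> flP; apply: flow_eq; rewrite ?flow_poly0 //; exact: flow_polyP. Qed.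

(** [X + c] has derivative 1 and coefficients killed by [E], so substituting it preserves the
    equation. This yields the group law [expED]. *)
Lemma flow_translate P c : flow P -> flow (P \Po ('X + c%:A%:P)).
Proof.
move=> flP; rewrite /flow deriv_comp flP derivD derivX derivC addr0 mulr1.
elim/poly_ind: P {flP} => [|P e IH]; first by rewrite map_poly0 !comp_poly0 map_poly0.
rewrite raddfD /= map_polyC /= !comp_polyD !comp_polyC raddfD /= map_polyC /=.
congr (_ + _); rewrite !comp_polyM !comp_polyX !map_derM map_der_translate.
by rewrite map_derX !mulr0 !addr0 comp_polyM comp_polyX IH.
Qed.

Definition expE c (r : A) := (flow_poly r).[c%:A].

Lemma expED c e r : expE c (expE e r) = expE (c + e) r.
Proof.
have coef0_translate : (flow_poly r \Po ('X + e%:A%:P))`_0 = expE e r.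
  by rewrite -horner_coef0 horner_comp !hornerE.
rewrite /expE -/(expE e r) -coef0_translate flow_polyE; last first.
  by apply: flow_translate; exact: flow_polyP.
by rewrite horner_comp !hornerE scalerDl.
Qed.

Lemma expE0 r : expE 0 r = r.
Proof. by rewrite /expE scale0r horner_coef0 flow_poly0. Qed.

Lemma flow_poly_eq r P : flow P -> P`_0 = r -> flow_poly r = P.
Proof. by move=> flP <-; exact: flow_polyE. Qed.

(** Linear combinations and products of flows are flows, so uniqueness identifies them by their
    constant terms; exp(-cE) is the inverse. *)
Lemma expE_automorphism c : is_automorphism (expE c).
Proof.
split.
- move=> e u v; rewrite /expE.
  rewrite (@flow_poly_eq _ (e%:A *: flow_poly u + flow_poly v)).
  + by rewrite hornerD hornerZ mulr_algl.
  + rewrite /flow derivD derivZ !flow_polyP raddfD /=; congr (_ + _).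
    by rewrite -!mul_polyC map_derM map_polyC /= der_scalar polyC0 mulr0 add0r.
  + by rewrite coefD coefZ !flow_poly0 mulr_algl.
- split=> [|u v]; rewrite /expE.
    rewrite (@flow_poly_eq _ 1) ?hornerC ?coef1 //.
    by rewrite /flow -polyC1 derivC map_polyC /= -[1]scale1r der_scalar.
  rewrite (@flow_poly_eq _ (flow_poly u * flow_poly v)) ?hornerM //.
    by rewrite /flow derivM !flow_polyP map_derM [flow_poly v * _]mulrC.
  by rewrite coef0M !flow_poly0.
- by exists (expE (- c)) => r; rewrite expED (addNr, addrN) expE0.
Qed.

Lemma expE_comm (d : {linear A -> A}) c : (forall r, E (d r) = d (E r)) ->
  forall r, expE c (d r) = d (expE c r).
Proof.
move=> Ed r; rewrite /expE (@flow_poly_eq _ (map_poly d (flow_poly r))).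
- rewrite (horner_coef_wide _ (size_poly _ _)) horner_coef linear_sum /=.
  apply: eq_bigr => j _; rewrite coef_map /=.
  by rewrite exprZn expr1n !mulr_algr linearZ.
- apply/polyP=> m; rewrite coef_deriv !coef_map /= -raddfMn -coef_deriv flow_polyP.
  by rewrite coef_map /= Ed.
- by rewrite coef_map /= flow_poly0.
Qed.

(** exp(E) lies in the isotropy group, hence is the identity. By induction on the nilpotency order
    E(E r) = 0, so exp(E) r = r + E r, whence E r = 0. *)
Lemma lnd_eq0 (d : {linear A -> A}) : (forall r, E (d r) = d (E r)) ->
  (forall rho : A -> A, isotropy d rho -> rho =1 id) -> forall r, E r = 0.
Proof.
move=> Ed triv r; have [m] := E_lnd r.
elim: m r => [|m IH] r; first by move=> /= ->; rewrite raddf0.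
rewrite iterSr => /IH EEr.
have flow_r : flow_poly r = E r *: 'X + r%:P.
  apply: flow_poly_eq; last by rewrite coefD coefZ coefX mulr0 add0r coefC.
  rewrite /flow derivD derivZ derivX derivC addr0 raddfD /= map_polyC /=.
  by rewrite -!mul_polyC map_derM map_derX map_polyC /= EEr polyC0 !mulr0 !add0r mulr1.
have isoE : isotropy d (expE 1).
  by split; [exact: expE_automorphism | exact: expE_comm].
have := triv _ isoE r; rewrite /expE flow_r !hornerE scale1r mulr1 /=.
by move/(canRL (addrK r)); rewrite subrr.
Qed.

End Exponential.

(** * Rigidity, the invariant carried from one ring of the tower to the next *)

Record rigid (k : fieldType) (S : comNzRingType) (eta : k -> S) (d : S -> S)
    (x : S) (N : nat) : Prop := Rigid {
  rigid_fg : finitely_generated eta;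
  rigid_no_primitive : no_primitive eta d x N;
  rigid_lndP : rigid_lnd eta d x;
  rigid_autP : rigid_aut eta d x
}.

(** The new bound [N] is free, so it can be chosen to suit the polynomial of the next extension. *)
Lemma rigid_poly (k : fieldType) (S : idomainType) (eta : {rmorphism k -> S})
    (d : {additive S -> S}) (D : {additive {poly S} -> {poly S}}) (x : S)
    (g : {poly k}) (N : nat) :
  [pchar k] =i pred0 -> derivation_over (polyC \o eta) D ->
  (forall s, D s%:P = (d s)%:P) ->
  D 'X = (map_poly eta g).[x]%:P -> (1 < size g)%N ->
  rigid eta d x (size g) -> rigid (polyC \o eta) D 'X N.
Proof.
move=> char0 D_der D_C D_X g_nc [fg prim lnd aut]; split.
- have [s sP] := fg; exists ('X :: [seq polyC u | u <- s]) => P Pk Padd Pmul Ps.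
  have PC u : P u%:P.
    move: u; apply: sP => [c|u v|u v|u u_s]; first exact: Pk.
    + by rewrite polyCD; apply: Padd.
    + by rewrite polyCM; apply: Pmul.
    + by apply: Ps; rewrite inE map_f ?orbT.
  elim/poly_ind=> [|p c Pp]; first exact: PC.
  by apply: Padd => //; apply: Pmul => //; apply: Ps; rewrite inE eqxx.
- exact: (no_primitive_poly char0 D_der D_C D_X g_nc prim).
- move=> E E_der E_lnd ED.
  have [c Ec] := lnd_poly char0 D_der D_C D_X g_nc prim E_der E_lnd ED lnd fg.
  exists c; first by rewrite Ec derivX mulr1.
  by move=> c0 p; rewrite Ec c0 rmorph0 mul0r.
- move=> rho rho_bij rho_k rho_D.
  have [rhoC [c rhoX]] :=
    aut_poly char0 D_der D_C D_X g_nc prim fg lnd aut rho_bij rho_k rho_D.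
  exists c => // c0; elim/poly_ind=> [|p s IH]; first by rewrite rmorph0.
  by rewrite rmorphD rmorphM /= IH rhoC rhoX c0 rmorph0 addr0.
Qed.

(** Serves to pass between [{poly {mpoly k[n]}}] and [{mpoly k[n.+1]}] and, with identity maps, to
    replace a derivation by a pointwise equal one. *)
Lemma rigid_iso (k : fieldType) (S S' : comNzRingType) (eta : {rmorphism k -> S})
    (eta' : {rmorphism k -> S'}) (phi : {rmorphism S -> S'})
    (psi : {rmorphism S' -> S}) (d : S -> S) (d' : S' -> S') (x : S) (N : nat) :
  cancel phi psi -> cancel psi phi -> (forall c, phi (eta c) = eta' c) ->
  (forall s, d' (phi s) = phi (d s)) -> rigid eta d x N -> rigid eta' d' (phi x) N.
Proof.
move=> phiK psiK phi_k phi_d [fg prim lnd aut].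
have psi_k c : psi (eta' c) = eta c by rewrite -phi_k phiK.
have psi_d s : psi (d' s) = d (psi s) by rewrite -{1}[s]psiK phi_d phiK.
split.
- have [s sP] := fg; exists [seq phi u | u <- s] => P Pk Padd Pmul Ps r.
  rewrite -[r]psiK; move: (psi r); apply: sP => [c|u v|u v|u u_s].
  + by rewrite phi_k.
  + by rewrite rmorphD; apply: Padd.
  + by rewrite rmorphM; apply: Pmul.
  + by apply: Ps; rewrite map_f.
- move=> h r size_h /(congr1 psi); rewrite psi_d -(horner_map psi) phiK -map_poly_comp.
  rewrite (eq_map_poly (psi_k : psi \o eta' =1 eta)) => /(prim _ _ size_h)[[c rc] ->].
  by split=> //; exists c; rewrite -phi_k -rc psiK.
- move=> E [EM Ek] E_lnd Ed.
  pose F : {additive S -> S} := psi \o E \o phi.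
  have [|r|r|c Fx F0] := lnd F.
  + split=> [u v|c]; rewrite /F /=; last by rewrite phi_k Ek rmorph0.
    by rewrite rmorphM EM rmorphD !rmorphM /= !phiK.
  + have [m Em] := E_lnd (phi r); exists m.
    suff -> t : iter t F r = psi (iter t E (phi r)) by rewrite Em rmorph0.
    by elim: t => [|t IH]; rewrite ?phiK //= IH /F /= psiK.
  + by rewrite /F /= -phi_d Ed psi_d.
  exists c; first by rewrite -phi_k -Fx /F /= psiK.
  by move=> /F0 {}F0 r; rewrite -[E r]psiK -{1}[r]psiK -[psi _]/(F _) F0 rmorph0.
- move=> rho [sigma rhoK sigmaK] rho_k rho_d.
  pose f : {rmorphism S -> S} := psi \o rho \o phi.
  have [|c|r|c fx f_id] := aut f.
  + exists (psi \o sigma \o phi) => r; rewrite /f /=.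
      by rewrite psiK rhoK phiK.
    by rewrite psiK sigmaK phiK.
  + by rewrite /f /= phi_k rho_k.
  + by rewrite /f /= -phi_d rho_d psi_d.
  exists c; first by rewrite -phi_k -rmorphD /= -fx /f /= psiK.
  by move=> /f_id {}f_id r; rewrite -[RHS]psiK -(f_id (psi r)) /f /= !psiK.
Qed.

(** Transports [aut_poly] itself, since [rigid_aut] does not record that [rho] fixes S when the
    constant is nonzero. *)
Lemma aut_poly_iso (k : fieldType) (S : idomainType) (T : comNzRingType)
    (eta : {rmorphism k -> S}) (eta' : k -> T)
    (phi : {rmorphism {poly S} -> T}) (psi : {rmorphism T -> {poly S}})
    (d : {additive S -> S}) (D : {additive {poly S} -> {poly S}}) (d' : T -> T)
    (x : S) (g : {poly k}) (rho : {rmorphism T -> T}) :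
  [pchar k] =i pred0 -> cancel phi psi -> cancel psi phi ->
  (forall c, phi (eta c)%:P = eta' c) -> (forall p, D p = psi (d' (phi p))) ->
  derivation_over (polyC \o eta) D -> (forall s, D s%:P = (d s)%:P) ->
  D 'X = (map_poly eta g).[x]%:P -> (1 < size g)%N -> rigid eta d x (size g) ->
  bijective rho -> (forall c, rho (eta' c) = eta' c) ->
  (forall r, rho (d' r) = d' (rho r)) ->
  (forall s, rho (phi s%:P) = phi s%:P) /\
  exists c, rho (phi 'X) = phi 'X + eta' c.
Proof.
move=> char0 phiK psiK phi_k D_d' D_der D_C D_X g_nc [fg prim lnd aut].
move=> rho_bij rho_k rho_d'.
pose f : {rmorphism {poly S} -> {poly S}} := psi \o rho \o phi.
have fE p : rho (phi p) = phi (f p) by rewrite /f /= psiK.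
have [||p|f_C [c f_X]] :=
    aut_poly char0 D_der D_C D_X g_nc prim fg lnd aut (rho := f).
- exact: (bij_comp (bij_comp (Bijective psiK phiK) rho_bij) (Bijective phiK psiK)).
- by move=> c; rewrite /f /= phi_k rho_k -phi_k phiK.
- by rewrite /f /= !D_d' !psiK rho_d'.
split=> [s|]; first by rewrite fE f_C.
by exists c; rewrite fE f_X rmorphD phi_k.
Qed.

(** * Identification of k[x_1, ..., x_(n+1)] with k[x_1, ..., x_n][X] *)

Section MPoly.
Variable k : fieldType.

Lemma mpoly_gen_ind n (P : {mpoly k[n]} -> Prop) :
  (forall c, P c%:MP) -> (forall p q, P p -> P q -> P (p + q)) ->
  (forall p q, P p -> P q -> P (p * q)) -> (forall j, P 'X_j) -> forall p, P p.
Proof.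
move=> PC Padd Pmul PX; elim/mpolyind=> [|c m p _ _ Pp]; first exact: (PC 0).
apply: Padd => //; rewrite -mul_mpolyC; apply: (Pmul) => //.
rewrite mpolyXE_id; apply: (big_ind P) => [||j _]; [exact: (PC 1) | exact: Pmul |].
by elim: (m j) => [|t IH]; [exact: (PC 1) | rewrite exprS; apply: Pmul].
Qed.

Lemma mpoly_rmorph_ext n (S : nzRingType) (f h : {rmorphism {mpoly k[n]} -> S}) :
  (forall c, f c%:MP = h c%:MP) -> (forall j, f 'X_j = h 'X_j) -> f =1 h.
Proof.
move=> fhC fhX; elim/mpoly_gen_ind=> // p q fp fq.
  by rewrite !rmorphD fp fq.
by rewrite !rmorphM /= fp fq.
Qed.

Definition ord_widen n : 'I_n -> 'I_n.+1 := widen_ord (leqnSn n).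

Lemma mwidenXU n (j : 'I_n) : mwiden ('X_j : {mpoly k[n]}) = 'X_(ord_widen j).
Proof. by rewrite mwidenX mnmwiden1. Qed.

Lemma ord_widenP n (j : 'I_n.+1) : {j' : 'I_n | j = ord_widen j'} + {j = ord_max}.
Proof.
have [j_n|j_n] := ltnP j n.
  by left; exists (Ordinal j_n); apply: val_inj.
by right; apply/val_inj/eqP; rewrite eqn_leq j_n andbT -ltnS /=.
Qed.

Lemma muniXU_widen n (j : 'I_n) :
  muni ('X_(ord_widen j) : {mpoly k[n.+1]}) = ('X_j)%:P.
Proof.
rewrite muniE msuppX big_seq1 mcoeffX eqxx scale1r mnm1E -val_eqE /=.
rewrite ltn_eqF // -mul_polyC mulr1; congr ('X_[_])%:P.
by apply/mnmP=> l; rewrite mnmE !mnm1E -!val_eqE.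
Qed.

Lemma muniXU_max n : muni ('X_ord_max : {mpoly k[n.+1]}) = 'X.
Proof.
rewrite muniE msuppX big_seq1 mcoeffX eqxx scale1r mnm1E eqxx expr1.
rewrite (_ : [multinom _ | _ < _] = 0%MM) ?mpolyX0 ?scale1r //.
by apply/mnmP=> l; rewrite mnmE mnm1E mnmE -val_eqE /= gtn_eqF.
Qed.

Lemma mwidenK n (p : {mpoly k[n]}) : muni (mwiden p) = p%:P.
Proof.
elim/mpoly_gen_ind: p => [c|p q IHp IHq|p q IHp IHq|j].
- by rewrite mwidenC muniC.
- by rewrite rmorphD rmorphD /= IHp IHq polyCD.
- by rewrite rmorphM rmorphM /= IHp IHq polyCM.
- by rewrite mwidenXU muniXU_widen.
Qed.

Definition unmuni n : {rmorphism {poly {mpoly k[n]}} -> {mpoly k[n.+1]}} :=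
  horner_eval 'X_ord_max \o map_poly (@mwiden n k).
Lemma unmuniC n (p : {mpoly k[n]}) : unmuni n p%:P = mwiden p.
Proof. by rewrite /unmuni /= /horner_eval map_polyC hornerC. Qed.

Lemma unmuniX n : unmuni n 'X = 'X_ord_max.
Proof. by rewrite /unmuni /= /horner_eval map_polyX hornerX. Qed.

Lemma unmuniK n : cancel (unmuni n) (@muni n k).
Proof.
elim/poly_ind=> [|p c IH]; first by rewrite !rmorph0.
by rewrite (rmorphD (unmuni n)) (rmorphM (unmuni n)) muniD muniM IH
  unmuniC unmuniX muniXU_max mwidenK.
Qed.

Lemma muniK n : cancel (@muni n k) (unmuni n).
Proof.
apply: (@mpoly_rmorph_ext _ _ (unmuni n \o @muni n k) idfun) => [c|j];
  rewrite -[LHS]/(unmuni n (muni _)).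
  by rewrite muniC unmuniC mwidenC.
have [[j' ->]|->] := ord_widenP j; first by rewrite muniXU_widen unmuniC mwidenXU.
by rewrite muniXU_max unmuniX.
Qed.

Lemma mwiden_in_var n (h : {poly k}) (j : 'I_n) :
  mwiden (in_var h j) = in_var h (ord_widen j).
Proof.
rewrite /in_var -(horner_map (@mwiden n k)) /= mwidenXU -map_poly_comp.
by congr (_.[_]); apply: eq_map_poly => c /=; rewrite mwidenC.
Qed.

Lemma inclXU m n (le_mn : (m <= n)%N) (j : 'I_m) :
  incl le_mn ('X_j : {mpoly k[m]}) = 'X_(widen_ord le_mn j).
Proof. by rewrite /incl comp_mpolyXU -tnth_nth tnth_mktuple. Qed.

Lemma incl_widen m n (le_mn : (m <= n)%N) (le_mSn : (m <= n.+1)%N) (p : {mpoly k[m]}) :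
  mwiden (incl le_mn p) = incl le_mSn p.
Proof.
elim/mpoly_gen_ind: p => [c|p q|p q|j]; rewrite /incl.
- by rewrite !comp_mpolyC mwidenC.
- by rewrite !comp_mpolyD rmorphD /= => -> ->.
- by rewrite !rmorphM /= => -> ->.
- rewrite -![_ \mPo _]/(incl _ _) !inclXU mwidenXU.
  by congr 'X__; exact: val_inj.
Qed.

Lemma incl_id n (le_nn : (n <= n)%N) (p : {mpoly k[n]}) : incl le_nn p = p.
Proof.
by rewrite -[RHS]comp_mpoly_id /incl; congr (_ \mPo _).
Qed.

Lemma derivation_mpoly n (d : {mpoly k[n]} -> {mpoly k[n]}) :
  is_derivation d -> derivation_over (@mpolyC n k) d.
Proof.
move=> [d_lin dM]; split=> // c.
pose d' : {linear {mpoly k[n]} -> {mpoly k[n]}} :=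
  HB.pack d (GRing.isLinear.Build _ _ _ _ d d_lin).
have := @der_scalar k {mpoly k[n]} d' (conj d_lin dM) c.
by rewrite -mul_mpolyC mulr1.
Qed.

End MPoly.

Lemma mpoly_fg (k : fieldType) n : finitely_generated (@mpolyC n k).
Proof.
exists [seq 'X_j | j <- enum 'I_n] => P Pk Padd Pmul PX.
by apply: mpoly_gen_ind => // j; apply: PX; apply/mapP; exists j; rewrite ?mem_enum.
Qed.

(** Base of the tower: both constants are 0, for derivations through [lnd_eq0] and for automorphisms
    directly from triviality of the isotropy group. *)
Lemma rigid_ground (k : fieldType) (n : nat) (d : {mpoly k[n]} -> {mpoly k[n]})
    (x : {mpoly k[n]}) (N : nat) :
  [pchar k] =i pred0 -> is_derivation d ->
  no_primitive (@mpolyC n k) d x N ->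
  (forall rho : {mpoly k[n]} -> {mpoly k[n]}, isotropy d rho -> rho =1 id) ->
  rigid (@mpolyC n k) d x N.
Proof.
move=> char0 [d_lin dM] prim triv; split=> //; first exact: mpoly_fg.
- move=> E [EM EC] E_lnd Ed.
  have E_lin : linear E.
    by move=> c p q; rewrite raddfD -!mul_mpolyC EM EC mulr0 add0r.
  pose E' : {linear {mpoly k[n]} -> {mpoly k[n]}} :=
    HB.pack (E : _ -> _) (GRing.isLinear.Build _ _ _ _ (E : _ -> _) E_lin).
  pose d' : {linear {mpoly k[n]} -> {mpoly k[n]}} :=
    HB.pack d (GRing.isLinear.Build _ _ _ _ d d_lin).
  have E0 := @lnd_eq0 k char0 _ E' (conj E_lin EM) E_lnd d' Ed triv.
  by exists 0 => //; rewrite mpolyC0; exact: E0.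
- move=> rho rho_bij rho_k rho_d; have rho_id : rho =1 id.
    apply: triv; split=> //; split=> //.
      by move=> c p q; rewrite rmorphD -!mul_mpolyC rmorphM /= rho_k.
    by split=> [|p q]; rewrite ?rmorph1 ?rmorphM.
  by exists 0; rewrite ?mpolyC0 ?addr0.
Qed.

(** * The tower of derivations between d_i and d_n *)

Lemma extension_restrict (k : fieldType) (i n : nat) (le_in : (i <= n)%N)
    (le_iSn : (i <= n.+1)%N) (di : {mpoly k[i]} -> {mpoly k[i]})
    (g : nat -> {poly k}) (dn' : {mpoly k[n.+1]} -> {mpoly k[n.+1]}) :
  (0 < i)%N -> is_extension le_iSn di g dn' ->
  exists2 dn : {mpoly k[n]} -> {mpoly k[n]}, is_extension le_in di g dn &
    forall p, dn' (mwiden p) = mwiden (dn p).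
Proof.
move=> i_gt0 [dn'_der dn'_incl dn'_X].
have [dn'_lin dn'M] := dn'_der.
have [_ dn'C] := derivation_mpoly dn'_der.
have dn'D p q : dn' (p + q) = dn' p + dn' q.
  by rewrite -[p]scale1r dn'_lin !scale1r.
have var_cases (j : 'I_n) : (exists2 j' : 'I_i, j = widen_ord le_in j' & True) \/
    exists2 a : 'I_n, a.+1 = j & (i <= j)%N.
  have [j_i|i_j] := ltnP j i.
    by left; exists (Ordinal j_i) => //; apply: val_inj.
  have j_gt0 : (0 < j)%N by exact: leq_trans i_j.
  have a_n : (j.-1 < n)%N by rewrite (leq_ltn_trans (leq_pred _)).
  by right; exists (Ordinal a_n); rewrite /= ?prednK.
(* Stability of the smaller ring is checked on generators: the variables of R_i stay in R_i, and a
   later one goes to a polynomial in its predecessor. *)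
have stable p : exists q, dn' (mwiden p) = mwiden q.
  elim/mpoly_gen_ind: p => [c|p q [p' p'E] [q' q'E]|p q [p' p'E] [q' q'E]|j].
  - by exists 0; rewrite mwidenC dn'C rmorph0.
  - by exists (p' + q'); rewrite !mwidenD dn'D p'E q'E.
  - by exists (q * p' + p * q'); rewrite mwidenM dn'M p'E q'E mwidenD !mwidenM.
  - have [[j' -> _]|[a a_j i_j]] := var_cases j.
      exists (incl le_in (di 'X_j')).
      by rewrite -inclXU !(incl_widen _ le_iSn) dn'_incl.
    exists (in_var (g j) a).
    by rewrite mwidenXU mwiden_in_var; apply: dn'_X.
pose restr p := (muni (dn' (mwiden p)))`_0.
have restrE p q : dn' (mwiden p) = mwiden q -> restr p = q.
  by rewrite /restr => ->; rewrite mwidenK coefC.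
exists restr; last by move=> p; have [q pq] := stable p; rewrite (restrE _ _ pq).
split.
- split=> [c p q|p q]; have [p' p'E] := stable p; have [q' q'E] := stable q;
    rewrite (restrE _ _ p'E) (restrE _ _ q'E); apply: restrE.
    by rewrite mwidenD mwidenZ dn'_lin p'E q'E mwidenD mwidenZ.
  by rewrite mwidenM dn'M p'E q'E mwidenD !mwidenM.
- by move=> p; apply: restrE; rewrite !(incl_widen _ le_iSn) dn'_incl.
- move=> j a b i_j a_j b_j; apply: restrE; rewrite mwidenXU mwiden_in_var.
  exact: dn'_X.
Qed.

(** Puts [dn'] in the shape required of [D] in the one-variable extension step. *)
Lemma extension_poly (k : fieldType) (n : nat) (gn : {poly k}) (a : 'I_n)
    (dn : {mpoly k[n]} -> {mpoly k[n]}) (dn' : {mpoly k[n.+1]} -> {mpoly k[n.+1]}) :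
  linear dn -> is_derivation dn' ->
  (forall p, dn' (mwiden p) = mwiden (dn p)) ->
  dn' 'X_ord_max = in_var gn (ord_widen a) ->
  exists (d : {additive {mpoly k[n]} -> {mpoly k[n]}})
    (D : {additive {poly {mpoly k[n]}} -> {poly {mpoly k[n]}}}),
  [/\ d =1 dn, (forall p, D p = muni (dn' (unmuni k n p))),
      derivation_over (polyC \o @mpolyC n k) D
    & (forall s, D s%:P = (d s)%:P) /\
      D 'X = (map_poly (@mpolyC n k) gn).['X_a]%:P].
Proof.
move=> dn_lin dn'_der dn'_dn dn'_X.
have dn'_derk := derivation_mpoly dn'_der.
pose d : {linear {mpoly k[n]} -> {mpoly k[n]}} :=
  HB.pack dn (GRing.isLinear.Build _ _ _ _ dn dn_lin).
pose d' : {linear {mpoly k[n.+1]} -> {mpoly k[n.+1]}} :=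
  HB.pack dn' (GRing.isLinear.Build _ _ _ _ dn' dn'_der.1).
exists d, (@muni n k \o d' \o unmuni k n); split=> //.
- split=> [p q|c]; rewrite -[LHS]/(muni (dn' (unmuni k n _))).
    by rewrite (rmorphM (unmuni k n)) dn'_der.2 muniD !muniM !unmuniK.
  by rewrite unmuniC mwidenC dn'_derk.2 muni0.
- split=> [s|]; rewrite -[LHS]/(muni (dn' (unmuni k n _))).
    by rewrite unmuniC dn'_dn mwidenK.
  by rewrite unmuniX dn'_X -mwiden_in_var mwidenK.
Qed.

(** * Induction on the number of variables *)

Section Main.
Variables (k : fieldType) (char0 : [pchar k] =i pred0) (i : nat) (i_gt0 : (0 < i)%N).
Variables (di : {mpoly k[i]} -> {mpoly k[i]}) (g : nat -> {poly k}).
Hypothesis ground : forall a : 'I_i, a.+1 = i ->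
  rigid (@mpolyC i k) di 'X_a (size (g i)).

(** The bound at level [n] is the size of [g n], the polynomial by which the next variable would be
    adjoined; above R_i, [rigid_poly] grants any bound. *)
Lemma rigid_extension n (le_in : (i <= n)%N) (a : 'I_n)
    (dn : {mpoly k[n]} -> {mpoly k[n]}) :
  (forall j, (i <= j < n)%N -> (1 < size (g j))%N) ->
  is_extension le_in di g dn -> a.+1 = n ->
  rigid (@mpolyC n k) dn 'X_a (size (g n)).
Proof.
elim: n => [|n IH] in le_in a dn *; first by case: a.
move=> g_nc dn_ext a_n; have [i_n|i_neq_n] := eqVneq i n.+1.
  (* At the bottom, [dn] and [di] agree pointwise, because [incl] is then the identity. *)
  subst i; apply: (@rigid_iso _ _ _ _ _ idfun idfun di) => //; last exact: ground.
  move=> p /=; have [_ dn_incl _] := dn_ext.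
  by have := dn_incl p; rewrite !incl_id.
have le_in' : (i <= n)%N by rewrite -ltnS ltn_neqAle i_neq_n.
have n_gt0 : (0 < n)%N by exact: leq_trans le_in'.
have b_n : (n.-1 < n)%N by rewrite prednK.
pose b := Ordinal b_n; have b_last : b.+1 = n by rewrite /= prednK.
have [d0 d0_ext dn_d0] := extension_restrict le_in' i_gt0 dn_ext.
have [d0_der _ _] := d0_ext; have [dn_der _ dn_X] := dn_ext.
have dn_Xmax : dn 'X_ord_max = in_var (g n) (ord_widen b) by exact: dn_X.
have [d [D [d_d0 D_dn D_der [D_C D_X]]]] :=
  extension_poly d0_der.1 dn_der dn_d0 dn_Xmax.
have rigid_d0 : rigid (@mpolyC n k) d0 'X_b (size (g n)).
  apply: IH d0_ext b_last => // j /andP[i_j j_n].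
  by apply: g_nc; rewrite i_j ltnW.
have rigid_d : rigid (@mpolyC n k) d 'X_b (size (g n)).
  exact: (@rigid_iso _ _ _ _ _ idfun idfun d0).
have rigid_D := rigid_poly (size (g n.+1)) char0 D_der D_C D_X
  (g_nc n (introT andP (conj le_in' (ltnSn n)))) rigid_d.
have -> : a = ord_max by apply: val_inj; case: a_n.
rewrite -unmuniX; apply: rigid_iso rigid_D => //.
- exact: unmuniK.
- exact: muniK.
- by move=> c; rewrite [LHS]unmuniC mwidenC.
- by move=> p; rewrite D_dn muniK.
Qed.

End Main.

(** * Translations of the last variable, and the isotropy group of d_n *)

Lemma shift_lastXU (k : fieldType) n (c : k) (j : 'I_n) :
  shift_last c 'X_j = if j.+1 == n then 'X_j + c%:MP else 'X_j.
Proof. by rewrite /shift_last comp_mpolyXU -tnth_nth tnth_mktuple. Qed.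

Lemma shift_last_widen (k : fieldType) n (c : k) (p : {mpoly k[n]}) :
  shift_last c (mwiden p) = mwiden p.
Proof.
apply: (mpoly_rmorph_ext (f := comp_mpoly _ \o @mwiden n k) (h := @mwiden n k)).
  by move=> e; rewrite /= mwidenC comp_mpolyC.
move=> j; rewrite /= mwidenXU -[LHS]/(shift_last c _) shift_lastXU.
by rewrite eqSS ltn_eqF /=.
Qed.

Lemma shift_lastD (k : fieldType) n (c e : k) (p : {mpoly k[n]}) :
  shift_last c (shift_last e p) = shift_last (c + e) p.
Proof.
apply: (mpoly_rmorph_ext (f := comp_mpoly _ \o comp_mpoly _) (h := comp_mpoly _)).
  by move=> u; rewrite /= !comp_mpolyC.
move=> j; rewrite -[LHS]/(shift_last c (shift_last e _)) -[RHS]/(shift_last _ _).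
rewrite !shift_lastXU; case: ifP => j_n; last by rewrite shift_lastXU j_n.
rewrite [LHS]comp_mpolyD comp_mpolyC -[X in X + _]/(shift_last c _) shift_lastXU j_n.
by rewrite mpolyCD addrA.
Qed.

Lemma shift_last0 (k : fieldType) n (p : {mpoly k[n]}) : shift_last 0 p = p.
Proof.
apply: (mpoly_rmorph_ext (f := comp_mpoly _) (h := idfun)).
  by move=> u; rewrite /= !comp_mpolyC.
move=> j; rewrite -[LHS]/(shift_last 0 _) shift_lastXU.
by case: ifP => //; rewrite mpolyC0 addr0.
Qed.

Lemma isotropy_eq (k : fieldType) (R : comAlgType k) (d rho sigma : R -> R) :
  rho =1 sigma -> isotropy d sigma -> isotropy d rho.
Proof.
move=> e [[lin [mor1 morM] bij] comm].
split=> [|r]; last by rewrite !e.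
split; last exact: eq_bij bij _ (fsym e).
  by move=> c u v; rewrite !e lin.
by split=> [|u v]; rewrite !e ?mor1 ?morM.
Qed.

Theorem theorem2p4 (k : fieldType) (char0 : [pchar k] =i pred0)
  (i n : nat) (hi : (2 <= i)%N) (hin : (i < n)%N)
  (di : {mpoly k[i]} -> {mpoly k[i]}) (di_der : is_derivation di)
  (di_neq0 : forall j : 'I_i, di 'X_j <> 0)
  (g : nat -> {poly k})
  (g_nonconst : forall j : nat, (i <= j < n)%N -> (1 < size (g j))%N)
  (dn : {mpoly k[n]} -> {mpoly k[n]})
  (dn_ext : is_extension (ltnW hin) di g dn)
  (l : option nat) (gi_deg : deg_le l (g i))
  (cond_i : forall (r : {mpoly k[i]}) (h : {poly k}),
     deg_le l h -> di r = in_var h (last_ord (ltnW hi)) ->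
     (exists c : k, r = c%:MP) /\ h = 0)
  (cond_ii : exists A : 'M[int]_i,
     corresponding_matrix di A /\ condition_star A)
  (cond_iii : forall rho : {mpoly k[i]} -> {mpoly k[i]},
     isotropy di rho <-> rho =1 id) :
  forall rho : {mpoly k[n]} -> {mpoly k[n]},
    isotropy dn rho <-> exists c : k, rho =1 shift_last c.
Proof.
have i_gt0 := ltnW hi.
(* Since deg g_i is at most l, condition (i) covers all polynomials of size up to that of [g i];
   condition (iii) gives the rest. *)
have ground (a : 'I_i) : a.+1 = i -> rigid (@mpolyC i k) di 'X_a (size (g i)).
  move=> a_i; apply: rigid_ground => // [h r size_h dr|rho /cond_iii//].
  apply: cond_i.
    by case: l gi_deg => //= m; apply: leq_trans.
  rewrite dr /in_var; congr (_.['X__]); apply: val_inj => /=.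
  by have := congr1 predn a_i.
(* From here the ring of the theorem has n+1 variables, and [{mpoly k[n]}] omits the last one. *)
case: n => [|n] in hin dn g_nonconst dn_ext *; first by [].
have le_in : (i <= n)%N := hin.
have n_gt0 : (0 < n)%N by exact: leq_trans le_in.
have b_n : (n.-1 < n)%N by rewrite prednK.
pose b := Ordinal b_n; have b_last : b.+1 = n by rewrite /= prednK.
have [d0 d0_ext dn_d0] := extension_restrict le_in i_gt0 dn_ext.
have [d0_der _ _] := d0_ext; have [dn_der _ dn_X] := dn_ext.
have dn_Xmax : dn 'X_ord_max = in_var (g n) (ord_widen b) by exact: dn_X.
have [d [D [d_d0 D_dn D_der [D_C D_X]]]] :=
  extension_poly d0_der.1 dn_der dn_d0 dn_Xmax.
have rigid_d0 : rigid (@mpolyC n k) d0 'X_b (size (g n)).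
  apply: (rigid_extension char0 i_gt0 ground _ d0_ext b_last).
  by move=> j /andP[i_j j_n]; apply: g_nonconst; rewrite i_j ltnW.
have rigid_d : rigid (@mpolyC n k) d 'X_b (size (g n)).
  exact: (@rigid_iso _ _ _ _ _ idfun idfun d0).
have g_nc : (1 < size (g n))%N by apply: g_nonconst; rewrite le_in /=.
move=> rho0; split=> [[[rho_lin rho_mor rho_bij] rho_dn]|[c rho_c]].
  pose rho : {rmorphism {mpoly k[n.+1]} -> {mpoly k[n.+1]}} := HB.pack rho0
    (GRing.isLinear.Build _ _ _ _ rho0 rho_lin)
    (GRing.isMonoidMorphism.Build _ _ rho0 rho_mor).
  have rhoC c : rho c%:MP = c%:MP.
    rewrite -[c%:MP]mulr1 mul_mpolyC -[c *: 1]addr0 [LHS]rho_lin.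
    by rewrite [rho0 1](rmorph1 rho) [rho0 0](rmorph0 rho).
  have [|rho_widen [c rho_X]] := aut_poly_iso (rho := rho) char0 (@unmuniK k n) (@muniK k n) _
    D_dn D_der D_C D_X g_nc rigid_d rho_bij rhoC rho_dn.
    by move=> c; rewrite unmuniC mwidenC.
  exists c; apply: (mpoly_rmorph_ext (f := rho) (h := comp_mpoly _)) => [e|j].
    by rewrite rhoC /= comp_mpolyC.
  rewrite -[RHS]/(shift_last c _).
  have [[j' ->]|->] := ord_widenP j.
    by rewrite -mwidenXU shift_last_widen -unmuniC rho_widen.
  by rewrite shift_lastXU eqxx -unmuniX rho_X.
apply: (isotropy_eq rho_c).
have [[dn_lin dnM] [_ dnC]] := (dn_der, derivation_mpoly dn_der).
have dnD p q : dn (p + q) = dn p + dn q.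
  by rewrite -[p]scale1r dn_lin !scale1r.
split.
  split; first by move=> e p q; rewrite /shift_last linearP.
    by split=> [|p q]; rewrite /shift_last ?rmorph1 ?rmorphM.
  by exists (shift_last (- c)) => p; rewrite shift_lastD (addNr, addrN) shift_last0.
(* Commutation is checked on generators: [dn] sends every variable to a polynomial free of the last
   variable, which the translation fixes, and kills [c]. *)
elim/mpoly_gen_ind=> [e|p q IHp IHq|p q IHp IHq|j].
- by rewrite dnC /shift_last comp_mpolyC dnC rmorph0.
- by rewrite dnD /shift_last !rmorphD /= dnD -!/(shift_last _ _) IHp IHq.
- rewrite dnM /shift_last rmorphD !rmorphM /= dnM.
  by rewrite -!/(shift_last _ _) IHp IHq.
have [[j' ->]|->] := ord_widenP j.
  by rewrite -mwidenXU shift_last_widen dn_d0 shift_last_widen.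
rewrite shift_lastXU eqxx dnD dnC addr0 dn_Xmax.
by rewrite -mwiden_in_var shift_last_widen.
Qed.
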